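(* Let $k$ be a field of characteristic $0$ and let $D\in\mathcal{J}=k((z))[x_0,x_1,x_2,\dots]$, encoding the differential equation $D(z,y,y',y'',\dots)=0$ on the punctured formal disc $\Delta^*=\operatorname{Spec} k((z))$. Suppose that the residue pairing endows (induces on) the derived space of solutions $\operatorname{dSol}(D)$ a Tate $(-1)$-symplectic form. Then $D=0$ admits a variational formulation, namely there is an $A\in\mathcal{J}$ with $\delta A=D$.
   Context: Notation. $\mathcal{K}=k((z))$. $\mathcal{J}=\mathcal{K}[x_0,x_1,\dots]$ is the differential algebra with derivation $\partial_z$ acting on $\mathcal{K}$ as $d/dz$ and by $\partial_z x_i=x_{i+1}$; $x_i$ stands for $y^{(i)}(z)$. Put $\partial_i=\partial/\partial x_i$. The variational derivative is $\delta=\sum_i(-1)^i\partial_z^i\partial_i:\mathcal{J}\to\mathcal{J}$. Loop space. $\mathcal{L}\mathbb{A}^1=\operatorname{colim}_n\operatorname{Spec}k[y_i\mid i\ge -n]$ is the ind-affine scheme whose $A$-points are $A((z))$; its topological algebra of functions is $\mathcal{O}(\mathcal{L}\mathbb{A}^1)=\lim_n k[y_i\mid i\ge -n]$. Put $\mathcal{A}=\lim_n\big(k[y_i\mid i\ge -n]((z))\big)$, which contains $y(z)=\sum_{i\in\mathbb{Z}}y_iz^i$ and its $z$-derivatives. $\mathcal{A}$ is also regarded as the globally trivial Tate sheaf on $\mathcal{L}\mathbb{A}^1$ with fibre $\mathcal{K}$. For $D\in\mathcal{J}$, $D_i\in\mathcal{O}(\mathcal{L}\mathbb{A}^1)$ denotes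 the $z^i$-coefficient of $D(z,y(z),y'(z),\dots)$. Derived solution space. $\operatorname{dSol}(D)$ is the derived ind-scheme obtained as the homotopy fibre over $0$ of the map $\mathcal{L}\mathbb{A}^1\to\mathcal{L}\mathbb{A}^1$ with components $(D_i)_{i\in\mathbb{Z}}$. It is modelled by the topological commutative differential graded algebra freely topologically generated by $y_i$ ($i\in\mathbb{Z}$) in degree $0$ and $\xi_j$ ($j\in\mathbb{Z}$) in degree $-1$, with differential $\xi_j\mapsto D_j$; that is, the limit over $n$ of the algebras generated by $y_i$, $i\ge -n$, and $\xi_j$, $j\ge -m(n)$, where $m(n)$ is nondecreasing in $n$, tends to infinity, and is such that $D_j$ vanishes in $k[y_i\mid i\ge -n]$ for $j<-m(n)$. Let $\iota:\operatorname{dSol}(D)\to\mathcal{L}\mathbb{A}^1$ be the natural map. The linearisation $\mathcal{L}(D):\mathcal{A}\to\mathcal{A}$ sends $w$ to the coefficient of $\epsilon$ in $D(z,y+\epsilon w,y'+\epsilon w',\dots)$ modulo $\epsilon^2$; it is a linear differential operator in $z$, linear over $\mathcal{O}(\mathcal{L}\mathbb{A}^1)$. There is an isomorphism $\mathbb{T}(\operatorname{dSol}(D))\cong\iota^*(\mathcal{A}\xrightarrow{\mathcal{L}(D)}\mathcal{A})$ (complex in degrees $0,1$), under which $\partial_{y_i}$ and $\partial_{\xi_i}$ correspond to $z^i$ in degrees $0$ and $1$ respectively. Tate symplectic forms. A derived ind-scheme $X$ is Tate if its cotangent complex $\mathbb{L}_X\in\mathbf{Pro}(QC(X))$ lies in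 the self-dual subcategory $\mathbf{Tate}(X)$ of Tate sheaves, so that $\mathbb{T}_X$ is the dual of $\mathbb{L}_X$; $\operatorname{dSol}(D)$ is Tate. A Tate $(-1)$-symplectic form on such $X$ is a closed $2$-form of degree $-1$ whose underlying $2$-form is non-degenerate, i.e. induces an equivalence $\mathbb{T}_X\cong\mathbb{L}_X[-1]$. Framing and the residue form. A framing of a derived ind-scheme $X$ equipped with a map $\iota$ to $\mathcal{L}\mathbb{A}^1$ is a lift of the tangent complex of $X$ along $\iota$ to a complex on $\mathcal{L}\mathbb{A}^1$. $\operatorname{dSol}(D)$ is framed by the complex $\mathcal{A}\xrightarrow{\mathcal{L}(D)}\mathcal{A}$. The residue form induces a $(-1)$-symplectic form on $\operatorname{dSol}(D)$ if $\operatorname{dSol}(D)$ admits a (Tate) $(-1)$-symplectic form which lifts to the framing, on which it acts as the residue form, i.e. by pairing the degree $0$ and degree $1$ copies of $\mathcal{A}$ via $(f,g)\mapsto\operatorname{res}_0(fg\,dz)$, this pairing being compatible with the differential $\mathcal{L}(D)$ over $\mathcal{L}\mathbb{A}^1$. In the coordinates $y_i$ (degree $0$) and $\xi_j$ (degree $-1$) on $\operatorname{dSol}(D)$ the form is $\omega_{\int}=\sum_{i\in\mathbb{Z}}dy_i\,d\xi_{-1-i}$, required to be closed for the internal differential induced by $\xi_j\mapsto D_j$ on the topological commutative differential graded algebra freely topologically generated by the $y_i$ and $\xi_j$ ($i,j\in\mathbb{Z}$) that models $\operatorname{dSol}(D)$. *)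

(* Defs.v *)
From HB Require Import structures.
From mathcomp Require Import all_boot all_order all_algebra finmap zify.
From mathcomp Require Import boolp classical_sets functions cardinality fsbigop.
From mathcomp.multinomials Require Import monalg.

Set Implicit Arguments.
Unset Strict Implicit.
Unset Printing Implicit Defensive.

Import Order.TTheory GRing.Theory Num.Theory.

Local Open Scope classical_set_scope.
Local Open Scope ring_scope.

(* Laurent series are functions int -> R that vanish below some index; the
   convolution sums below have finite support. *)
Section LaurentDef.
Variable R : comNzRingType.

Definition laurent_pred : pred (int -> R) :=
  fun f => `[< exists N : int, forall i, i < N -> f i = 0 >].

Record laurent := Laurent { lcoef :> int -> R; _ : laurent_pred lcoef }.

HB.instance Definition _ := [isSub for lcoef].
HB.instance Definition _ := [Choice of laurent by <:].

Fact laurent_zmod_closed : zmod_closed laurent_pred.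
Proof.
split=> [|f g /asboolP[N fN] /asboolP[M gM]]; apply/asboolP.
  by exists 0.
exists (Order.min N M) => i; rewrite lt_min => /andP[iN iM].
by rewrite /GRing.add /= /GRing.opp /= fN // gM // subr0.
Qed.

HB.instance Definition _ :=
  GRing.isZmodClosed.Build (int -> R) laurent_pred laurent_zmod_closed.
HB.instance Definition _ := [SubChoice_isSubZmodule of laurent by <:].

Lemma laurentP (f g : laurent) : (forall i, f i = g i) <-> f = g.
Proof. by split=> [fg|-> //]; apply/val_inj/funext. Qed.

Lemma lcoefD (f g : laurent) i : (f + g) i = f i + g i. Proof. by []. Qed.
Lemma lcoefN (f : laurent) i : (- f) i = - f i. Proof. by []. Qed.
Lemma lcoef0 i : (0 : laurent) i = 0. Proof. by []. Qed.

Lemma laurent_bound (f : laurent) :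
  exists N : int, forall i, i < N -> f i = 0.
Proof. by case: f => f /= /asboolP. Qed.

Definition conv (f g : int -> R) (n : int) : R :=
  \sum_(i \in [set: int]) f i * g (n - i).

Lemma convE (f g : int -> R) (N M : int) (a : nat) :
    (forall i, i < N -> f i = 0) -> (forall i, i < M -> g i = 0) ->
  conv f g (N + M + a%:Z) =
  \sum_(j < a.+1) f (N + j%:Z) * g (M + (a - j)%N%:Z).
Proof.
move=> fN gM; rewrite /conv.
rewrite -(@fsbig_widen _ _ _ _ [set N + j%:Z | j in `I_a.+1]) //=; last first.
  move=> i [_ /= iP]; case: (ltP i N) => [/fN->|Ni]; first by rewrite mul0r.
  have [j def_i] : exists j : nat, i = N + j%:Z by exists (absz (i - N)%R); lia.
  suff /gM -> : N + M + a%:Z - i < M by rewrite mulr0.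
  suff : (a < j)%N by lia.
  by rewrite ltnNge; apply/negP=> ja; apply: iP; exists j => //; rewrite -ltnS.
rewrite fsbig_image; last by move=> i j _ _ /addrI [].
rewrite -fsbig_ord; apply: eq_bigr => j _; congr (_ * g _).
by have := ltn_ord j; lia.
Qed.

Lemma conv_lt (f g : int -> R) (N M n : int) :
    (forall i, i < N -> f i = 0) -> (forall i, i < M -> g i = 0) ->
  n < N + M -> conv f g n = 0.
Proof.
move=> fN gM nNM; apply: fsbig1 => i _; case: (ltP i N) => [/fN->|Ni].
  by rewrite mul0r.
by rewrite gM ?mulr0 //; lia.
Qed.

Fact conv_laurent (f g : laurent) : laurent_pred (conv f g).
Proof.
have [N fN] := laurent_bound f; have [M gM] := laurent_bound g.
by apply/asboolP; exists (N + M) => i; apply: conv_lt.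
Qed.

Definition lmul (f g : laurent) : laurent := Laurent (conv_laurent f g).

Fact lconst_laurent (c : R) : laurent_pred (fun i => if i == 0 then c else 0).
Proof. by apply/asboolP; exists 0 => i; case: eqVneq => // ->. Qed.

Definition lconst (c : R) : laurent := Laurent (lconst_laurent c).

Let tr (K : nat) (f : laurent) (N : int) : {poly R} :=
  \poly_(j < K) f (N + j%:Z).

Let lmulE (f g : laurent) (N M : int) (a K : nat) :
    (forall i, i < N -> f i = 0) -> (forall i, i < M -> g i = 0) -> (a < K)%N ->
  lmul f g (N + M + a%:Z) = (tr K f N * tr K g M)`_a.
Proof.
move=> fN gM aK; rewrite /= convE // coefM; apply: eq_bigr => j _.
by have := ltn_ord j; rewrite !coef_poly ltnS => ja; rewrite !ifT //; lia.
Qed.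

Let lmul_bound (f g : laurent) (N M : int) :
    (forall i, i < N -> f i = 0) -> (forall i, i < M -> g i = 0) ->
  forall i, i < N + M -> lmul f g i = 0.
Proof. by move=> fN gM i; apply: conv_lt. Qed.

Let tr_lmul (f g : laurent) (N M : int) (a K : nat) :
    (forall i, i < N -> f i = 0) -> (forall i, i < M -> g i = 0) -> (a < K)%N ->
  (tr K (lmul f g) (N + M))`_a = (tr K f N * tr K g M)`_a.
Proof. by move=> fN gM aK; rewrite coef_poly aK (lmulE (K := K)). Qed.

Fact lmulA : associative lmul.
Proof.
move=> f g h; apply/laurentP => n.
have [N fN] := laurent_bound f; have [M gM] := laurent_bound g.
have [P hP] := laurent_bound h.
have fgN := lmul_bound fN gM; have ghM := lmul_bound gM hP.
case: (ltP n (N + M + P)) => [nlt|nge].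
  by rewrite (lmul_bound fgN hP) // (lmul_bound fN ghM) // addrA.
have [a ->] : exists a : nat, n = N + M + P + a%:Z.
  by exists (absz (n - (N + M + P))%R); lia.
rewrite (lmulE fgN hP (ltnSn a)) -(addrA N M P) (lmulE fN ghM (ltnSn a)).
rewrite coefM [RHS]coefM.
under eq_bigr => j _ do rewrite tr_lmul ?ltnS ?leq_subr //.
under [RHS]eq_bigr => j _ do rewrite tr_lmul //.
by rewrite -coefM -[RHS]coefM mulrA.
Qed.

Fact lmulC : commutative lmul.
Proof.
move=> f g; apply/laurentP => n.
have [N fN] := laurent_bound f; have [M gM] := laurent_bound g.
case: (ltP n (N + M)) => [nlt|nge].
  by rewrite (lmul_bound fN gM) // (lmul_bound gM fN) // addrC.
have [a ->] : exists a : nat, n = N + M + a%:Z.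
  by exists (absz (n - (N + M))%R); lia.
rewrite (lmulE fN gM (ltnSn a)) (addrC N M).
by rewrite (lmulE gM fN (ltnSn a)) mulrC.
Qed.

Fact lmul1 : left_id (lconst 1) lmul.
Proof.
move=> f; apply/laurentP => n; rewrite /= /conv.
rewrite -(@fsbig_widen _ _ _ _ [set 0]) //; last first.
  by move=> i /= [_ /eqP/negbTE->]; rewrite mul0r.
by rewrite fsbig_set1 eqxx mul1r subr0.
Qed.

Fact lmulDl : left_distributive lmul +%R.
Proof.
move=> f g h; apply/laurentP => n; rewrite lcoefD.
have [N1 fN] := laurent_bound f; have [N2 gN] := laurent_bound g.
have [P hP] := laurent_bound h; pose N := Order.min N1 N2.
have fN' i : i < N -> f i = 0 by rewrite lt_min => /andP[/fN].
have gN' i : i < N -> g i = 0 by rewrite lt_min => /andP[_ /gN].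
have fgN i : i < N -> (f + g) i = 0.
  by move=> iN; rewrite lcoefD fN' ?gN' ?addr0.
case: (ltP n (N + P)) => [nlt|nge].
  rewrite (lmul_bound fgN hP) // (lmul_bound fN' hP) //.
  by rewrite (lmul_bound gN' hP) // addr0.
have [a ->] : exists a : nat, n = N + P + a%:Z.
  by exists (absz (n - (N + P))%R); lia.
rewrite (lmulE fgN hP (ltnSn a)) (lmulE fN' hP (ltnSn a)).
rewrite (lmulE gN' hP (ltnSn a)) -coefD -mulrDl; congr (polyseq (_ * _))`_a.
apply/polyP => i; rewrite coefD !coef_poly.
by case: ifP => // _; rewrite addr0.
Qed.

Fact lconst1_neq0 : lconst 1 != 0.
Proof.
by apply/eqP => /laurentP/(_ 0)/eqP; rewrite lcoef0 /= oner_eq0.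
Qed.

HB.instance Definition _ := GRing.Zmodule_isComNzRing.Build laurent
  lmulA lmulC lmul1 lmulDl lconst1_neq0.

Lemma lcoefM (f g : laurent) n : (f * g) n = conv f g n. Proof. by []. Qed.
Lemma lcoef1 n : (1 : laurent) n = (n == 0)%:R.
Proof. by rewrite [LHS]/=; case: eqP. Qed.

Definition lderiv_fun (f : int -> R) : int -> R :=
  fun i => f (i + 1) *~ (i + 1).

Fact lderiv_laurent (f : laurent) : laurent_pred (lderiv_fun f).
Proof.
have [N fN] := laurent_bound f; apply/asboolP; exists (N - 1) => i iN.
by rewrite /lderiv_fun fN ?mul0rz //; lia.
Qed.

Definition lderiv (f : laurent) : laurent := Laurent (lderiv_laurent f).

End LaurentDef.

Section LaurentMap.
Variables (R S : comNzRingType) (phi : {rmorphism R -> S}).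

Fact lmap_laurent (f : laurent R) : laurent_pred (phi \o f).
Proof.
have [N fN] := laurent_bound f.
by apply/asboolP; exists N => i iN; rewrite /= fN ?rmorph0.
Qed.

Definition lmap (f : laurent R) : laurent S := Laurent (lmap_laurent f).

Fact lmap_is_zmod_morphism : zmod_morphism lmap.
Proof. by move=> f g; apply/laurentP => i; rewrite /= rmorphB. Qed.

HB.instance Definition _ :=
  GRing.isZmodMorphism.Build _ _ lmap lmap_is_zmod_morphism.

Fact lmap_is_monoid_morphism : monoid_morphism lmap.
Proof.
split.
  apply/laurentP => i; rewrite [LHS]/= !lcoef1 /=.
  by case: eqP; rewrite ?rmorph1 ?rmorph0.
move=> f g; apply/laurentP => n.
have [N fN] := laurent_bound f; have [M gM] := laurent_bound g.
have fN' i : i < N -> lmap f i = 0 by move=> /fN /= ->; rewrite rmorph0.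
have gM' i : i < M -> lmap g i = 0 by move=> /gM /= ->; rewrite rmorph0.
rewrite lcoefM [LHS]/=; case: (ltP n (N + M)) => [nlt|nge].
  by rewrite !(@conv_lt _ _ _ N M) ?rmorph0.
have [a ->] : exists a : nat, n = N + M + a%:Z.
  by exists (absz (n - (N + M))%R); lia.
rewrite !convE // rmorph_sum; apply: eq_bigr => j _.
by rewrite rmorphM.
Qed.

HB.instance Definition _ :=
  GRing.isMonoidMorphism.Build _ _ lmap lmap_is_monoid_morphism.

End LaurentMap.

(* lim_n R_n as a ring of sequences, where R_n is the image of the idempotent
   tau n : R -> R and R_(n+1) -> R_n is the restriction of tau n. *)
Section Limit.
Variables (R : comNzRingType) (tau : nat -> {rmorphism R -> R}).

Definition limit_pred : pred (nat -> R) :=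
  fun f => `[< forall n, tau n (f n.+1) = f n >].

Record limit := Limit { level :> nat -> R; _ : limit_pred level }.

HB.instance Definition _ := [isSub for level].
HB.instance Definition _ := [Choice of limit by <:].

Fact limit_subring_closed : subring_closed limit_pred.
Proof.
split=> [|f g /asboolP fP /asboolP gP|f g /asboolP fP /asboolP gP];
  apply/asboolP => n.
- exact: rmorph1.
- by rewrite [LHS]rmorphB fP gP.
- by rewrite [LHS]rmorphM fP gP.
Qed.

HB.instance Definition _ :=
  GRing.isSubringClosed.Build (nat -> R) limit_pred limit_subring_closed.
HB.instance Definition _ := [SubChoice_isSubComNzRing of limit by <:].

Lemma limitP (f g : limit) : (forall n, f n = g n) <-> f = g.
Proof. by split=> [fg|-> //]; apply/val_inj/funext. Qed.

Lemma limitE (f : limit) n : tau n (f n.+1) = f n.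
Proof. by case: f => f /= /asboolP. Qed.

End Limit.

Notation polys R I := {malg R[{cmonom I}]}.

Section Polys.
Variables (I : choiceType) (R : comNzRingType).

Definition pvar (i : I) : polys R I := << ucm i >>.

Definition pderiv (i : I) (p : polys R I) : polys R I :=
  \sum_(m <- msupp p) << p@_m *+ m i *g divcm m (ucm i) >>.

Variable S : comNzRingType.

Definition mon_eval (s : I -> S) (m : {cmonom I}) : S :=
  \prod_(i <- finsupp m) s i ^+ m i.

Fact mon_eval_mmorphism s : mmorphism (mon_eval s).
Proof.
have widen (d : {fset I}) (m : {cmonom I}) : (finsupp m `<=` d)%fset ->
    mon_eval s m = \prod_(i <- d) s i ^+ m i.
  move=> md; rewrite /mon_eval (big_fset_incl _ md) // => i _ /negPf mi.
  by move: mi; rewrite -cmE_neq0 => /negbFE/eqP ->; rewrite expr0.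
split=> [m1 m2|]; last by rewrite /mon_eval mdom1 big_seq_fset0.
pose d := (finsupp m1 `|` finsupp m2)%fset.
rewrite (widen d (mmul m1 m2)) ?mdomD // (widen d m1) ?fsubsetUl //.
rewrite (widen d m2) ?fsubsetUr // -big_split; apply: eq_bigr => i _ /=.
by rewrite cmM exprD.
Qed.

HB.instance Definition _ s :=
  isMultiplicative.Build {cmonom I} S (mon_eval s) (mon_eval_mmorphism s).

(* The ring morphism extending c : R -> S with x_i |-> s i. *)
Definition psubst (c : {rmorphism R -> S}) (s : I -> S) : polys R I -> S :=
  mmap c (mon_eval s).

HB.instance Definition _ c s := GRing.RMorphism.on (psubst c s).

Lemma psubstC c s a : psubst c s a%:MP = c a.
Proof. exact: mmapC. Qed.

Lemma psubstX c s i : psubst c s (pvar i) = s i.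
Proof.
rewrite /psubst /pvar mmapU /= rmorph1 mul1r /mon_eval mdomU.
by rewrite big_seq_fset1 cmUU expr1.
Qed.

End Polys.

Section LoopSpace.
Variable k : fieldType.

(* k[y_i | i in Z]; the image of ptrunc n is k[y_i | i >= -n]. *)
Definition yalg := polys k int.

Definition ytrunc (n : nat) (i : int) : yalg :=
  if - n%:Z <= i then pvar k i else 0.

Definition ptrunc (n : nat) : {rmorphism yalg -> yalg} :=
  psubst (@mkmalgU {cmonom int} k mone) (ytrunc n).

(* O(LA^1) = lim_n k[y_i | i >= -n] *)
Definition loopO := limit ptrunc.

(* lim_n k[y_i | i >= -n]((z)) *)
Definition loopA := limit (fun n => lmap (ptrunc n)).

Fact acoef_limit (f : loopA) (i : int) :
  limit_pred ptrunc (fun n => f n i).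
Proof. by apply/asboolP => n; rewrite -[f n]limitE. Qed.

Definition acoef (f : loopA) (i : int) : loopO := Limit (acoef_limit f i).

Definition residue (f : loopA) : loopO := acoef f (-1).

Fact aderiv_limit (f : loopA) :
  limit_pred (fun n => lmap (ptrunc n)) (fun n => lderiv (f n)).
Proof.
apply/asboolP => n; apply/laurentP => i; rewrite -[f n]limitE.
by rewrite /= /lderiv_fun /= rmorphMz.
Qed.

Definition aderiv (f : loopA) : loopA := Limit (aderiv_limit f).

Fact aconst_limit (c : laurent k) :
  limit_pred (fun n => lmap (ptrunc n))
    (fun n => lmap (@mkmalgU {cmonom int} k mone) c).
Proof.
by apply/asboolP => n; apply/laurentP => i; rewrite /= psubstC.
Qed.

Definition aconst (c : laurent k) : loopA := Limit (aconst_limit c).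

Fact aconst_is_zmod_morphism : zmod_morphism aconst.
Proof. by move=> c d; apply/limitP => n; rewrite /= rmorphB. Qed.
HB.instance Definition _ :=
  GRing.isZmodMorphism.Build _ _ aconst aconst_is_zmod_morphism.
Fact aconst_is_monoid_morphism : monoid_morphism aconst.
Proof.
by split=> [|c d]; apply/limitP => n; rewrite /= (rmorph1, rmorphM).
Qed.
HB.instance Definition _ :=
  GRing.isMonoidMorphism.Build _ _ aconst aconst_is_monoid_morphism.

(* y(z) = \sum_i y_i z^i *)
Fact yseries_laurent (n : nat) : laurent_pred (ytrunc n).
Proof.
apply/asboolP; exists (- n%:Z) => i; rewrite /ytrunc ltNge.
by move=> /negbTE ->.
Qed.

Fact yseries_limit : limit_pred (fun n => lmap (ptrunc n))
  (fun n => Laurent (yseries_laurent n)).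
Proof.
apply/asboolP => n; apply/laurentP => i; rewrite /= {2}/ytrunc.
case: ifP => [_|ni]; first by rewrite psubstX.
by rewrite rmorph0 /ytrunc; case: ifP => //; lia.
Qed.

Definition yseries : loopA := Limit yseries_limit.

(* J = k((z))[x_0, x_1, ...] *)
Definition diffalg := polys (laurent k) nat.

Definition dz (f : diffalg) : diffalg :=
  \sum_(m <- msupp f) << lderiv f@_m *g m >>
  + \sum_(i \in [set: nat]) pvar _ i.+1 * pderiv i f.

Definition variational_derivative (f : diffalg) : diffalg :=
  \sum_(i \in [set: nat]) (-1) ^+ i * iter i dz (pderiv i f).

(* D(z, y, y', ...) *)
Definition deval : diffalg -> loopA :=
  psubst aconst (fun i => iter i aderiv yseries).

(* D(z, y + e w, y' + e w', ...) as a polynomial in e *)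
Definition deval_eps (D : diffalg) (w : loopA) : {poly loopA} :=
  psubst (polyC \o aconst)
    (fun i => (iter i aderiv yseries)%:P + (iter i aderiv w)%:P * 'X) D.

Definition linearisation (D : diffalg) (w : loopA) : loopA :=
  (deval_eps D w)`_1.

Definition dcoef (D : diffalg) (j : int) : loopO := acoef (deval D) j.

(* d/dy_i on lim_n k[y_i | i >= -n]: differentiate at a level containing y_i. *)
Definition oderiv (i : int) (f : loopO) (n : nat) : yalg :=
  ptrunc n (pderiv i (f (n + absz i)%N)).

(* The de Rham algebra of k[y_i, xi_j] is the graded-commutative algebra on
   y_i, xi_j, dy_i, dxi_j, where the sign rule uses the total parity
   (internal degree + weight): y_i, dxi_j are even and dy_i, xi_j are odd.
   Both families are indexed by gen:
                    even   odd
        inl i       y_i    dy_i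
        inr j       dxi_j  xi_j
   The coefficient of a form at S : {fset gen} is its (polynomial)
   coefficient on the product of the odd generators in S, taken in
   increasing order for gen_le. *)

Definition gen : choiceType := (int + int)%type.

Definition gen_le (g h : gen) : bool :=
  match g, h with
  | inl i, inl j => i <= j
  | inl _, inr _ => true
  | inr _, inl _ => false
  | inr i, inr j => i <= j
  end.

Definition evens := polys k gen.
Definition forms := {malg evens[{fset gen}]}.

(* Sign of moving the odd generator g to its place among those of S. *)
Definition gsign (g : gen) (S : {fset gen}) : evens :=
  (-1) ^+ #|` [fset h in S | (h != g) && gen_le h g]%fset|.

(* Left multiplication by, and left derivative along, an odd generator. *)
Definition odd_mul (g : gen) (f : forms) : forms :=
  \sum_(S <- msupp f | g \notin S) << gsign g S * f@_S *g (g |` S)%fset >>.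

Definition odd_deriv (g : gen) (f : forms) : forms :=
  \sum_(S <- msupp f | g \in S) << gsign g S * f@_S *g (S `\ g)%fset >>.

Definition even_deriv (g : gen) (f : forms) : forms :=
  \sum_(S <- msupp f) << pderiv g f@_S *g S >>.

Definition form_mul (f h : forms) : forms :=
  \sum_(S <- msupp f) f@_S *: foldr odd_mul h (sort gen_le S).

Definition even_form (p : evens) : forms := << p *g fset0 >>.

Definition yform (p : yalg) : forms :=
  even_form (psubst (@mkmalgU {cmonom gen} k mone)
               (fun i => pvar k (inl i : gen)) p).

Definition de_rham (f : forms) : forms :=
  \sum_(i \in [set: int]) odd_mul (inl i) (even_deriv (inl i) f)
  + \sum_(j \in [set: int])
      form_mul (even_form (pvar k (inr j : gen))) (odd_deriv (inr j) f).

(* The derivation with y_i |-> 0, xi_j |-> D_j, dy_i |-> 0,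
   dxi_j |-> - d(D_j), over the subalgebra k[y_i | i >= -n]. *)
Definition internal_d (D : diffalg) (n : nat) (f : forms) : forms :=
  \sum_(j \in [set: int])
     form_mul (yform (dcoef D j n)) (odd_deriv (inr j) f)
  - \sum_(j \in [set: int])
     form_mul (de_rham (yform (dcoef D j n))) (even_deriv (inr j) f).

Definition is_xi (g : gen) : bool := if g is inr _ then true else false.

(* Weight and internal degree of the product of the even monomial mu and
   the odd generators in S. *)
Definition form_weight (mu : {cmonom gen}) (S : {fset gen}) : nat :=
  (\sum_(g <- finsupp mu | is_xi g) mu g
   + #|` [fset g in S | ~~ is_xi g]%fset|)%N.

Definition form_degree (mu : {cmonom gen}) (S : {fset gen}) : int :=
  - (\sum_(g <- finsupp mu | is_xi g) mu g
     + #|` [fset g in S | is_xi g]%fset|)%N%:Z.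

Definition homogeneous (p : nat) (e : int) (f : forms) : Prop :=
  forall S mu, (f@_S)@_mu != 0 -> form_weight mu S = p /\ form_degree mu S = e.

(* dSol(D) is modelled by the limit over n of the algebras on y_i, i >= -n,
   and xi_j, j >= -m(n). *)
Definition admissible (D : diffalg) (m : nat -> int) : Prop :=
  [/\ {homo m : n p / (n <= p)%N >-> n <= p},
      forall c : int, exists n, c <= m n
    & forall n j, j < - m n -> dcoef D j n = 0].

Definition in_level (m : nat -> int) (n : nat) (g : gen) : bool :=
  match g with inl i => - n%:Z <= i | inr j => - m n <= j end.

(* Kill the generators that are not in level n. *)
Definition form_trunc (m : nat -> int) (n : nat) (f : forms) : forms :=
  \sum_(S <- msupp f | all (in_level m n) S)
    << psubst (@mkmalgU {cmonom gen} k mone)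
         (fun g => if in_level m n g then pvar k g else 0) f@_S *g S >>.

(* Compatible sequences of p-forms of internal degree e; the functions of
   degree e are the case p = 0. *)
Definition dsol_form (m : nat -> int) (p : nat) (e : int)
    (f : nat -> forms) : Prop :=
  (forall n, form_trunc m n (f n.+1) = f n)
  /\ (forall n, homogeneous p e (f n)).

(* A derivative along g is computed at a level that contains g. *)
Definition gen_level (m : nat -> int) (g : gen) : nat :=
  xget 0%N [set n | in_level m n g].

Definition lim_deriv (dg : forms -> forms) (m : nat -> int) (g : gen)
    (f : nat -> forms) (n : nat) : forms :=
  form_trunc m n (dg (f (maxn n (gen_level m g)))).

(* Sections of the tangent complex: the continuous derivations of the
   algebra of functions, given by their values on y_i and xi_j. Continuity
   means that, at every level, v(y_i) and v(xi_i) vanish for i << 0. *)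
Definition vfield (m : nat -> int) (e : int) (v : gen -> nat -> forms) : Prop :=
  [/\ forall i, dsol_form m 0 e (v (inl i)),
      forall j, dsol_form m 0 (e - 1) (v (inr j))
    & forall n, exists N : int, forall i, i < N ->
        v (inl i) n = 0 /\ v (inr i) n = 0].

(* The graded commutator of the internal differential with v, of degree e:
   Q v(y_i) and Q v(xi_j) - (-1)^e v(D_j). *)
Definition vfield_d (D : diffalg) (e : int) (v : gen -> nat -> forms) :
    gen -> nat -> forms :=
  fun g n => match g with
  | inl i => internal_d D n (v (inl i) n)
  | inr j => internal_d D n (v (inr j) n)
      - (-1) ^+ absz e *:
        \sum_(i \in [set: int])
          form_mul (v (inl i) n) (yform (oderiv i (dcoef D j) n))
  end.

Definition contract (m : nat -> int) (v : gen -> nat -> forms)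
    (f : nat -> forms) (n : nat) : forms :=
  \sum_(i \in [set: int])
    form_mul (v (inl i) n) (lim_deriv (odd_deriv (inl i)) m (inl i) f n)
  + \sum_(j \in [set: int])
    form_mul (v (inr j) n) (lim_deriv (even_deriv (inr j)) m (inr j) f n).

(* A closed 2-form of degree -1: om 2 + om 3 + ... with om p a p-form of
   degree 1 - p, closed for the sum of de Rham and internal differentials. *)
Record closed_2form (D : diffalg) (m : nat -> int) (om : nat -> nat -> forms) :
    Prop := {
  closed_form : forall p, (2 <= p)%N -> dsol_form m p (1 - p%:Z) (om p);
  closed_internal : forall n, internal_d D n (om 2%N n) = 0;
  closed_de_rham : forall p n, (2 <= p)%N ->
    de_rham (om p n) + internal_d D n (om p.+1 n) = 0 }.

(* Contraction with om induces an isomorphism from the cohomology of the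
   tangent complex to that of the cotangent complex shifted by -1. *)
Definition nondegenerate (D : diffalg) (m : nat -> int)
    (om : nat -> forms) : Prop :=
  forall e : int,
  (forall v b, vfield m e v -> (forall g n, vfield_d D e v g n = 0) ->
     dsol_form m 1 (e - 2) b ->
     (forall n, contract m v om n = internal_d D n (b n)) ->
     exists2 u, vfield m (e - 1) u &
       forall g n, v g n = vfield_d D (e - 1) u g n)
  /\
  (forall a, dsol_form m 1 (e - 1) a -> (forall n, internal_d D n (a n) = 0) ->
     exists v b, [/\ vfield m e v, (forall g n, vfield_d D e v g n = 0),
       dsol_form m 1 (e - 2) b &
       forall n, a n = contract m v om n + internal_d D n (b n)]).

Definition tate_symplectic (D : diffalg) (m : nat -> int)
    (om : nat -> nat -> forms) : Prop :=
  closed_2form D m om /\ nondegenerate D m (om 2%N).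

(* \sum_i dy_i dxi_(-1-i) *)
Definition residue_form (m : nat -> int) (n : nat) : forms :=
  \sum_(i \in [set i : int |
              in_level m n (inl i) && in_level m n (inr (-1 - i))])
    odd_mul (inl i) (even_form (pvar k (inr (-1 - i) : gen))).

(* The framing of dSol(D) is the complex L(D) : A -> A in degrees 0 and 1;
   its elements are pairs (degree 0 part, degree 1 part). *)
Definition framing_d (D : diffalg) (u : loopA * loopA) : loopA * loopA :=
  (0, linearisation D u.1).

(* The residue pairing of the two copies of A, extended as a 2-form of degree
   -1, hence antisymmetrically between degrees 0 and 1. *)
Definition framing_pairing (u v : loopA * loopA) : loopO :=
  residue (u.1 * v.2) - residue (u.2 * v.1).

(* Both terms vanish unless u and v have degree 0, so that the sign (-1)^|u|
   in front of the second one is always 1. *)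
Definition framing_compatible (D : diffalg) : Prop :=
  forall u v : loopA * loopA,
    framing_pairing (framing_d D u) v + framing_pairing u (framing_d D v) = 0.

Definition residue_induces_symplectic (D : diffalg) : Prop :=
  framing_compatible D /\
  exists2 m, admissible D m &
    exists2 om, tate_symplectic D m om & om 2%N = residue_form m.

End LoopSpace.

(* Main.v *)
(* Write L for the linearisation of D, with partial derivatives D_i, and L^* for
   its formal adjoint w |-> sum_i (-1)^i dz^i (D_i w). Only the compatibility of
   the residue pairing with the framing is needed: pairing y with z^j for all j
   and integrating by parts gives L y = L^* y in A. The evaluation J -> A is
   injective in characteristic 0, because over k[y_i | i >= 0] the series y^(i)
   is i! y_i + O(z), so that the lowest z-coefficient of an element of J can be
   recovered from its value. Hence sum_i x_i D_i = sum_i (-1)^i dz^i (x_0 D_i)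
   holds in J, which is the part of the Helmholtz conditions that is used by the
   Vainberg-Tonti formula: if T divides the monomials of degree d by d + 1 then
   A = x_0 T(D) satisfies
     delta A = T (D + sum_i (-1)^i dz^i (x_0 D_i)) = T (D + sum_i x_i D_i)
             = D. *)
From HB Require Import structures.
Require Import Defs.
From mathcomp Require Import all_boot all_order all_algebra finmap zify.
From mathcomp Require Import boolp classical_sets fsbigop.
From mathcomp.multinomials Require Import monalg.

Set Implicit Arguments.
Unset Strict Implicit.
Unset Printing Implicit Defensive.

Import Order.TTheory GRing.Theory Num.Theory.

Local Open Scope classical_set_scope.
Local Open Scope ring_scope.

(** * Additive maps, in particular those defined term by term on polynomials *)

Section ZmodMorphism.
Variables U V W : zmodType.

Lemma zmod_morphismD (h : U -> V) :
  zmod_morphism h -> forall a b, h (a + b) = h a + h b.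
Proof.
move=> hB a b; have h0 : h 0 = 0 by rewrite -(subrr 0) hB subrr.
by rewrite -[b in LHS]opprK hB -(sub0r b) hB h0 sub0r opprK.
Qed.

Lemma zmod_morphism_comp (h : V -> W) (h' : U -> V) :
  zmod_morphism h -> zmod_morphism h' -> zmod_morphism (fun a => h (h' a)).
Proof. by move=> hB hB' a b; rewrite hB' hB. Qed.

Lemma zmod_morphism_add (h h' : U -> V) :
  zmod_morphism h -> zmod_morphism h' -> zmod_morphism (fun a => h a + h' a).
Proof. by move=> hB hB' a b; rewrite hB hB' opprD addrACA. Qed.

Lemma zmod_morphism_mulrn n : zmod_morphism (fun a : U => a *+ n).
Proof. by move=> a b; rewrite mulrnBl. Qed.

End ZmodMorphism.

Lemma zmod_morphism_mul (R : nzRingType) (a : R) : zmod_morphism ( *%R a).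
Proof. by move=> b c; rewrite mulrBr. Qed.

Section MsuppSum.
Variables (K : choiceType) (G H : zmodType) (phi : K -> G -> H).
Hypothesis phiB : forall m, zmod_morphism (phi m).

(** Common shape of [pderiv], of the coefficientwise part of [dz], of division by degree and of the
    slices below, so that additivity and the value on a monomial are proved once. *)
Definition msupp_sum (f : {malg G[K]}) : H := \sum_(m <- msupp f) phi m f@_m.

Let phi0 m : phi m 0 = 0. Proof. by have := phiB m 0 0; rewrite !subrr. Qed.

Let msupp_sumEw (d : {fset K}) f : (msupp f `<=` d)%fset ->
  msupp_sum f = \sum_(m <- d) phi m f@_m.
Proof.
by move=> le; apply: (big_fset_incl _ le) => m _ /mcoeff_outdom ->; apply: phi0.
Qed.

(** Since [phi m 0 = 0], the three sums may all be taken over the union of the supports of [f] and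
    [g]. *)
Lemma msupp_sum_is_zmod_morphism : zmod_morphism msupp_sum.
Proof.
move=> f g; pose d := (msupp f `|` msupp g)%fset.
rewrite (@msupp_sumEw d) ?msuppB_le // (@msupp_sumEw d f) ?fsubsetUl //.
rewrite (@msupp_sumEw d g) ?fsubsetUr // -sumrB; apply: eq_bigr => m _.
by rewrite mcoeffB phiB.
Qed.

Lemma msupp_sumU c m : msupp_sum << c *g m >> = phi m c.
Proof. by rewrite (msupp_sumEw msuppU_le) big_seq_fset1 mcoeffUU. Qed.

End MsuppSum.

(** * Polynomials in arbitrary families of variables and their partial derivatives *)

Section PolyTheory.
Variables (I : choiceType) (R : comNzRingType).
Implicit Types (f g : polys R I) (m : {cmonom I}).

Lemma polys_monom_ind (P : polys R I -> Prop) :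
    (forall f g, P f -> P g -> P (f + g)) -> (forall c m, P << c *g m >>) ->
  forall f, P f.
Proof.
move=> PD PU f; rewrite (monalgE f); apply: big_ind => //.
by rewrite -(monalgU0 mone).
Qed.

Lemma polys_additive_ext (V : zmodType) (A B : polys R I -> V) :
    zmod_morphism A -> zmod_morphism B ->
    (forall c m, A << c *g m >> = B << c *g m >>) ->
  A =1 B.
Proof.
move=> AB BB ABU f.
elim/polys_monom_ind: f => // f g fE gE.
rewrite (zmod_morphismD AB f g).
exact: etrans (congr2 +%R fE gE) (esym (zmod_morphismD BB f g)).
Qed.

Lemma pvarMU i (c : R) m : pvar R i * << c *g m >> = << c *g mmul (ucm i) m >>.
Proof. by rewrite malgM_def fgmulUU mul1r. Qed.

(** Induction on the degree: a monomial other than [mone] has a variable in its support, and one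
    copy of it is split off. *)
Lemma cmonom_ind (P : {cmonom I} -> Prop) :
  P mone -> (forall i m, P m -> P (mmul (ucm i) m)) -> forall m, P m.
Proof.
move=> P1 PM m; move: {2}(mdeg m) (erefl (mdeg m)) => n.
elim: n m => [|n IHn] m degm; first by rewrite (mdeg_eq0I degm).
have [m1|] := eqVneq (finsupp m) fset0.
  by move: degm; rewrite mdegE m1 big_seq_fset0.
case/fset0Pn=> i; rewrite -cmE_neq0 => mi.
have def_m : m = mmul (ucm i) (divcm m (ucm i)).
  apply/eqP/cmP => j; rewrite cmM divcmE cmU; case: eqVneq => [<-|] /=.
    by move: (m i) mi => a; lia.
  by rewrite subn0.
rewrite def_m; apply/PM/IHn.
by move: degm; rewrite {1}def_m mdegM mdegU => -[].
Qed.

Lemma polys_ind (P : polys R I -> Prop) :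
    (forall c, P c%:MP) -> (forall f g, P f -> P g -> P (f + g)) ->
    (forall i f, P f -> P (pvar R i * f)) ->
  forall f, P f.
Proof.
move=> PC PD PM; apply: polys_monom_ind => // c; elim/cmonom_ind => [|i m Pm].
  exact: PC.
by rewrite -pvarMU; apply: PM.
Qed.

Let pderiv_term i m (c : R) : polys R I :=
  << c *+ m i *g divcm m (ucm i) >>.

Let pderiv_termB i m : zmod_morphism (pderiv_term i m).
Proof. by move=> c d; rewrite /pderiv_term mulrnBl monalgUB. Qed.

Fact pderiv_is_zmod_morphism i : zmod_morphism (@pderiv I R i).
Proof. exact: (msupp_sum_is_zmod_morphism (pderiv_termB i)). Qed.

Lemma pderivU i (c : R) m :
  pderiv i << c *g m >> = << c *+ m i *g divcm m (ucm i) >>.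
Proof. exact: (msupp_sumU (pderiv_termB i)). Qed.

Lemma pderivC i (c : R) : pderiv i (c%:MP : polys R I) = 0.
Proof. by rewrite pderivU cm1 mulr0n monalgU0. Qed.

(** Together with [pderivC] and additivity this determines [pderiv]; the abstract differential ring
    below assumes only these rules. *)
Lemma pderivXM i j f :
  pderiv i (pvar R j * f) = f *+ (i == j) + pvar R j * pderiv i f.
Proof.
move: f; apply: polys_additive_ext => [||c m].
- exact: zmod_morphism_comp (pderiv_is_zmod_morphism i) (zmod_morphism_mul _).
- exact: zmod_morphism_add (zmod_morphism_mulrn _)
    (zmod_morphism_comp (zmod_morphism_mul _) (pderiv_is_zmod_morphism i)).
apply: etrans (etrans (congr1 (pderiv i) (pvarMU j c m)) (pderivU _ _ _)) _.
apply: etrans (congr2 +%R (erefl _)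
  (esym (etrans (congr1 _ (pderivU i c m)) (pvarMU _ _ _)))).
rewrite cmM cmU eq_sym; case: eqVneq => [<-|ij].
  have -> : divcm (mmul (ucm i) m) (ucm i) = m.
    by apply/eqP/cmP => l; rewrite divcmE cmM addKn.
  (* Exponents in [divcm] are truncated at [0], so multiplying back by [ucm i] restores [m] only if
     [m i] is positive; otherwise the coefficient [c *+ m i] is [0]. *)
  rewrite mulr1n mulrS monalgUD; case mi: (m i) => [|a].
    by rewrite !mulr0n !monalgU0.
  have -> // : mmul (ucm i) (divcm m (ucm i)) = m.
  apply/eqP/cmP => l; rewrite cmM divcmE cmU; case: eqVneq => [<-|] /=.
    by rewrite mi subn1.
  by rewrite subn0.
rewrite add0n mulr0n add0r.
have -> // : divcm (mmul (ucm j) m) (ucm i) = mmul (ucm j) (divcm m (ucm i)).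
apply/eqP/cmP => l; rewrite !(cmM, divcmE) !cmU.
by case: (eqVneq i l) => [<-|il]; rewrite ?subn0 // eq_sym (negPf ij).
Qed.

End PolyTheory.

Lemma fsbig_nat_sum (V : zmodType) (F : nat -> V) n :
    (forall i, (n <= i)%N -> F i = 0) ->
  \sum_(i \in [set: nat]) F i = \sum_(i < n) F i.
Proof.
move=> F0; rewrite fsbig_ord; apply/esym/fsbig_widen => // i [_ /= /negP].
by rewrite -leqNgt => /F0.
Qed.

(** * Derivation, constants and powers of the coordinate for Laurent series *)

Section LaurentTheory.
Variable R : comNzRingType.
Implicit Types f g : laurent R.

Fact lderiv_is_zmod_morphism : zmod_morphism (@lderiv R).
Proof.
by move=> f g; apply/laurentP => i; exact: mulrzBl.
Qed.

Lemma lderivM f g : lderiv (f * g) = lderiv f * g + f * lderiv g.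
Proof.
apply/laurentP => n; have [N fN] := laurent_bound f.
have [M gM] := laurent_bound g; rewrite lcoefD !lcoefM.
change (conv f g (n + 1) *~ (n + 1) =
  conv (lderiv f) g n + conv f (lderiv g) n); rewrite /conv.
(* After this shift all three sums have terms [f i * g (n + 1 - i)], with the factors [n + 1], [i]
   and [n + 1 - i]. *)
rewrite [X in _ = X + _](reindex_fsbigT (fun i : int => i - 1)); last first.
  by exists (fun i => i + 1) => i; rewrite (addrK, subrK).
(* A finite window containing every [i] with [N <= i] and [M <= n + 1 - i], hence the support of all
   three sums. *)
pose d : {fset int} :=
  [fset (N + j%:Z)%R | j in iota 0 (absz (n + 1 - M - N)%R).+1]%fset.
have d_out i : i \notin d -> i < N \/ n + 1 - i < M.
  case: (ltP i N) => [|Ni]; first by left.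
  case: (ltP (n + 1 - i) M) => [|iM id]; first by right.
  case/negP: id; apply/imfsetP; exists (absz (i - N)); last by rewrite /=; lia.
  by rewrite mem_iota; lia.
have fg0 i : i \notin d -> f i * g (n + 1 - i) = 0.
  by move=> /d_out [/fN->|/gM->]; rewrite ?mul0r ?mulr0.
have f'g0 i : i \notin d -> lderiv f (i - 1) * g (n - (i - 1)) = 0.
  move=> /d_out; rewrite /= /lderiv_fun subrK => -[/fN->|].
    by rewrite mul0rz mul0r.
  by rewrite opprB addrA => /gM->; rewrite mulr0.
have fg'0 i : i \notin d -> f i * lderiv g (n - i) = 0.
  move=> /d_out [/fN->|]; first by rewrite mul0r.
  by rewrite /= /lderiv_fun addrAC => /gM->; rewrite mul0rz mulr0.
rewrite (fsbigTE _ _ fg0) (fsbigTE _ _ f'g0) (fsbigTE _ _ fg'0).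
rewrite mulrz_suml -big_split; apply: eq_bigr => i _ /=.
rewrite /lderiv_fun subrK opprB addrA (addrAC n (- i)).
by rewrite mulrzAl mulrzAr -mulrzDr; congr (_ *~ _); lia.
Qed.

Lemma lcoef_lderivn0 f n : iter n (@lderiv R) f 0 = f n%:Z *+ n`!.
Proof.
elim: n f => [|n IHn] f; first by rewrite fact0.
rewrite iterSr IHn /= /lderiv_fun factS mulrnA.
by have -> : n%:Z + 1 = n.+1 by lia.
Qed.

Lemma lderivn_lt0 f n : (forall i, i < 0 -> f i = 0) ->
  forall i, i < 0 -> iter n (@lderiv R) f i = 0.
Proof.
move=> f0; elim: n => // n IHn i i0; rewrite /= /lderiv_fun.
(* The coefficient at [-1] comes from the constant term, which differentiation multiplies by [0]. *)
have [->|i1] := eqVneq (i + 1) 0; first by rewrite mulr0z.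
by rewrite IHn ?mul0rz //; lia.
Qed.

Fact lconst_is_zmod_morphism : zmod_morphism (@lconst R).
Proof.
move=> a b; apply/laurentP => i.
change (lconst (a - b) i = lconst a i - lconst b i) => /=.
by case: eqP; rewrite ?subr0.
Qed.

Lemma lcoef_lconstM (c : R) f n : (lconst c * f) n = c * f n.
Proof.
rewrite lcoefM /conv -(@fsbig_widen _ _ _ _ [set 0]) //.
  by rewrite fsbig_set1 subr0.
by move=> i /= [_ /eqP/negbTE->]; rewrite mul0r.
Qed.

Lemma lderiv_lconstM (c : R) f : lderiv (lconst c * f) = lconst c * lderiv f.
Proof.
apply/laurentP => i; rewrite lcoef_lconstM.
change ((lconst c * f) (i + 1) *~ (i + 1) = c * (f (i + 1) *~ (i + 1))).
by rewrite lcoef_lconstM mulrzAr.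
Qed.

Fact zpow_laurent (j : int) : laurent_pred (fun i => (i == j)%:R : R).
Proof.
by apply/asboolP; exists j => i; case: eqVneq => // ->; rewrite ltxx.
Qed.

Definition zpow (j : int) : laurent R := Laurent (zpow_laurent j).

Lemma lcoefMzpow f j n : (f * zpow j) n = f (n - j).
Proof.
rewrite lcoefM /conv -(@fsbig_widen _ _ _ _ [set n - j]) //.
  have nnj : n - (n - j) = j by lia.
  by rewrite fsbig_set1 nnj /= eqxx mulr1.
move=> i /= [_ ij]; case: eqVneq => [nij|_]; last by rewrite mulr0.
by case: ij => /=; lia.
Qed.

End LaurentTheory.

(** * Integration by parts and variational calculus in an abstract differential ring *)

Lemma residue_by_parts (B O : nzRingType) (d : B -> B)
    (res : {additive B -> O}) :
    (forall a b, d (a * b) = d a * b + a * d b) -> (forall a, res (d a) = 0) ->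
  forall n a b, res (a * iter n d b) = (-1) ^+ n * res (iter n d a * b).
Proof.
move=> dM res_d; elim=> [|n IHn] a b; first by rewrite mul1r.
rewrite iterS; have /eqP := res_d (a * iter n d b).
rewrite dM raddfD addrC addr_eq0 => /eqP->; rewrite IHn -iterSr.
by rewrite exprS -mulrA mulN1r.
Qed.

(* [J] plays the role of [diffalg k]; it is kept abstract because conversion
   between concrete polynomials is intractable. *)
Section DifferentialRing.
Variables (K J : comNzRingType) (cst : {rmorphism K -> J}) (x : nat -> J).
Hypothesis J_ind : forall P : J -> Prop,
  (forall c, P (cst c)) -> (forall f g, P f -> P g -> P (f + g)) ->
  (forall j f, P f -> P (x j * f)) -> forall f, P f.

Variable (pd : nat -> {additive J -> J}).
Hypothesis pd_cst : forall i c, pd i (cst c) = 0.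
Hypothesis pd_xM : forall i j f,
  pd i (x j * f) = f *+ (i == j) + x j * pd i f.

Lemma pd_eventually0 f : exists N, forall n, (N <= n)%N -> pd n f = 0.
Proof.
elim/J_ind: f => [c|f g [N fN] [M gM]|j f [N fN]].
- by exists 0%N => n _; apply: pd_cst.
- by exists (maxn N M) => n le_n; rewrite raddfD fN ?gM ?addr0 //; lia.
- exists (maxn N j.+1) => n le_n; rewrite pd_xM fN; last by lia.
  by rewrite mulr0 addr0; case: eqVneq => // nj; lia.
Qed.

Lemma sum_mulrn_eq n j (F : nat -> J) (f : J) : (j < n)%N ->
  \sum_(i < n) F i * (f *+ (i == j :> nat)) = F j * f.
Proof.
move=> jn; rewrite (bigD1 (Ordinal jn)) //= eqxx big1 ?addr0 // => i.
by rewrite -val_eqE /= => /negPf->; rewrite mulr0n mulr0.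
Qed.

(** Leibniz rule for the derivation [x i |-> F i]: [F i = x i.+1] gives [shift_deriv] and [F = x]
    the Euler operator. *)
Lemma sum_pd_xM n j (F : nat -> J) f : (j < n)%N ->
  \sum_(i < n) F i * pd i (x j * f) = F j * f + x j * \sum_(i < n) F i * pd i f.
Proof.
move=> jn; rewrite -(sum_mulrn_eq F f jn) mulr_sumr -big_split.
by apply: eq_bigr => i _; rewrite pd_xM mulrDr mulrCA.
Qed.

Lemma eq_sum_pd (V : zmodType) n n' f (F : nat -> J -> V) :
    (forall i, F i 0 = 0) ->
    (forall i, (n <= i)%N -> pd i f = 0) ->
    (forall i, (n' <= i)%N -> pd i f = 0) ->
  \sum_(i < n) F i (pd i f) = \sum_(i < n') F i (pd i f).
Proof.
move=> F0 fn fn'; have G m := @fsbig_nat_sum V (fun i => F i (pd i f)) m.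
by rewrite -!G // => i /[dup] => [/fn'|/fn] ->.
Qed.

(** The part of the total derivative that treats the coefficients as constants. *)
Definition shift_deriv f : J := \sum_(i \in [set: nat]) x i.+1 * pd i f.

Lemma shift_derivE n f : (forall i, (n <= i)%N -> pd i f = 0) ->
  shift_deriv f = \sum_(i < n) x i.+1 * pd i f.
Proof. by move=> f0; apply: fsbig_nat_sum => i /f0->; rewrite mulr0. Qed.

Lemma shift_deriv_cst c : shift_deriv (cst c) = 0.
Proof. by apply: fsbig1 => i _; rewrite pd_cst mulr0. Qed.

Lemma shift_deriv_xM j f :
  shift_deriv (x j * f) = x j.+1 * f + x j * shift_deriv f.
Proof.
have [N fN] := pd_eventually0 f; have [M xfM] := pd_eventually0 (x j * f).
pose n := maxn j.+1 (maxn N M).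
rewrite (@shift_derivE n f) => [|i le_i]; last by rewrite fN //; lia.
rewrite (@shift_derivE n) => [|i le_i]; last by rewrite xfM //; lia.
by rewrite (sum_pd_xM (fun i => x i.+1)) //; lia.
Qed.

Lemma shift_deriv_is_zmod_morphism : zmod_morphism shift_deriv.
Proof.
move=> f g; have [N fN] := pd_eventually0 f; have [M gM] := pd_eventually0 g.
pose n := maxn N M.
have fn i : (n <= i)%N -> pd i f = 0 by move=> le_i; rewrite fN //; lia.
have gn i : (n <= i)%N -> pd i g = 0 by move=> le_i; rewrite gM //; lia.
rewrite (shift_derivE fn) (shift_derivE gn) (@shift_derivE n) => [|i le_i].
  by rewrite -sumrB; apply: eq_bigr => i _; rewrite raddfB mulrBr.
by rewrite raddfB fn ?gn ?subrr.
Qed.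

Variables (D : {additive J -> J}) (delta : K -> K).
Hypothesis D_cst : forall c, D (cst c) = cst (delta c).
Hypothesis D_xM : forall j f, D (x j * f) = x j.+1 * f + x j * D f.

(* [T s] divides the monomials of degree d by d + s; the shift s is what makes
   it compatible with multiplication by [x j] and with [pd i]. *)
Variables (T : nat -> {additive J -> J}) (t : nat -> K).
Hypothesis T_cst : forall s c, T s (cst c) = cst (t s * c).
Hypothesis T_xM : forall s j f, T s (x j * f) = x j * T s.+1 f.
Hypothesis delta_t : forall s c, delta (t s * c) = t s * delta c.
Hypothesis t_mulrn : forall s, t s.+1 *+ s.+1 = 1.

(** [D] preserves the degree in the variables, and [delta] commutes with the scalars [t s]. *)
Lemma T_D s f : T s (D f) = D (T s f).
Proof.
elim/J_ind: f s => [c|f g IHf IHg|j f IHf] s.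
- by rewrite D_cst !T_cst D_cst delta_t.
- by rewrite !raddfD IHf IHg.
- by rewrite D_xM raddfD !T_xM IHf D_xM.
Qed.

Lemma T_iterD s n f : T s (iter n D f) = iter n D (T s f).
Proof. by elim: n => //= n <-; rewrite T_D. Qed.

(** [pd i] lowers the degree by one, and [d + s = (d - 1) + s.+1]. *)
Lemma pd_T s i f : pd i (T s f) = T s.+1 (pd i f).
Proof.
elim/J_ind: f s => [c|f g IHf IHg|j f IHf] s.
- by rewrite T_cst !pd_cst raddf0.
- by rewrite !raddfD IHf IHg.
- by rewrite T_xM !pd_xM raddfD T_xM raddfMn IHf.
Qed.

(** By Euler's identity the argument of [T s.+1] is [f] with its part of degree [d] multiplied by
    [d + s.+1]. The induction needs all [s] at once, because pulling out [x j] raises [s] by one. *)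
Lemma euler_T f : exists N, forall n s, (N <= n)%N ->
  T s.+1 (\sum_(i < n) x i * pd i f + f *+ s.+1) = f.
Proof.
elim/J_ind: f => [c|f g [N fN] [M gM]|j f [N fN]].
- exists 0%N => n s _; rewrite big1 => [|i _]; last by rewrite pd_cst mulr0.
  by rewrite add0r -raddfMn T_cst mulrnAr -mulrnAl t_mulrn mul1r.
- exists (maxn N M) => n s le_n; rewrite mulrnDl.
  under eq_bigr do rewrite raddfD mulrDr.
  by rewrite big_split addrACA raddfD fN ?gM //; lia.
- exists (maxn N j.+1) => n s le_n; rewrite sum_pd_xM; last by lia.
  rewrite addrAC -mulrS -mulrnAr addrC -mulrDr T_xM fN //; lia.
Qed.

Lemma vainberg_tonti f (A := x 0 * T 1 f) :
    (exists N, forall n, (N <= n)%N ->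
      \sum_(i < n) (-1) ^+ i * iter i D (x 0 * pd i f) =
      \sum_(i < n) x i * pd i f) ->
  exists N, forall n, (N <= n)%N ->
    \sum_(i < n) (-1) ^+ i * iter i D (pd i A) = f.
Proof.
move=> [N fN]; have [M fM] := euler_T f.
exists (maxn 1 (maxn N M)) => n le_n.
have n0 : (0 < n)%N by lia.
(* Euler's identity with [s = 0] turns [f] into [T 1] of a sum, to which the adjointness hypothesis
   applies. *)
rewrite -[RHS](fM n 0) //; last by lia.
rewrite -fN; last by lia.
rewrite raddfD raddf_sum addrC mulr1n.
(* Only [pd 0] differentiates the factor [x 0] of [A]; this produces the separate summand
   [T 1 f]. *)
rewrite (bigD1 (Ordinal n0)) //= [in RHS](bigD1 (Ordinal n0)) //= addrA.
congr (_ + _).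
  by rewrite !expr0 !mul1r pd_xM eqxx pd_T T_xM.
apply: eq_bigr => i /negPf i0.
rewrite pd_xM -val_eqE /= in i0 *; rewrite i0 mulr0n add0r pd_T -T_xM -T_iterD.
(* The sign is a ring element and [T] is merely additive, so the sign passes through [T] by
   parity. *)
by rewrite -signr_odd !mulr_sign; case: odd; rewrite ?raddfN.
Qed.

(** * Evaluation at a point of a differential ring, formal adjoint and linearisation *)

Variables (B : comNzRingType) (ev : {rmorphism J -> B}).
Variables (dB : {additive B -> B}) (y : B).
Hypothesis dBM : forall a b, dB (a * b) = dB a * b + a * dB b.
Hypothesis dB_cst : forall c, dB (ev (cst c)) = ev (cst (delta c)).
Hypothesis ev_x : forall i, ev (x i) = iter i dB y.

Lemma ev_D f : ev (D f) = dB (ev f).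
Proof.
elim/J_ind: f => [c|f g IHf IHg|j f IHf].
- by rewrite D_cst dB_cst.
- by rewrite raddfD rmorphD IHf IHg rmorphD raddfD.
- by rewrite D_xM rmorphD !rmorphM dBM IHf !ev_x.
Qed.

Lemma ev_iterD n f : ev (iter n D f) = iter n dB (ev f).
Proof. by elim: n => //= n <-; rewrite ev_D. Qed.

(** Integration by parts moves the derivatives off [w]. Since [y] is itself the value of [x 0], the
    adjoint operator applied to [y] is again the value of an element of [J]. *)
Lemma residue_adjoint (O : nzRingType) (res : {additive B -> O}) n f w :
    (forall a, res (dB a) = 0) ->
  res (y * \sum_(i < n) ev (pd i f) * iter i dB w) =
  res (ev (\sum_(i < n) (-1) ^+ i * iter i D (x 0 * pd i f)) * w).
Proof.
move=> res_dB; rewrite rmorph_sum mulr_suml mulr_sumr !raddf_sum.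
apply: eq_bigr => i _; rewrite mulrA (residue_by_parts dBM) //.
rewrite rmorphM rmorph_sign ev_iterD rmorphM ev_x /= -mulrA.
rewrite -[in LHS]signr_odd -[in RHS]signr_odd !mulr_sign.
by case: odd; rewrite ?raddfN.
Qed.

Variables (w : B) (ev_eps : {rmorphism J -> {poly B}}).
Hypothesis ev_eps_cst : forall c, ev_eps (cst c) = (ev (cst c))%:P.
Hypothesis ev_eps_x : forall i,
  ev_eps (x i) = (iter i dB y)%:P + (iter i dB w)%:P * 'X.

Lemma ev_eps_coef0 f : (ev_eps f)`_0 = ev f.
Proof.
elim/J_ind: f => [c|f g IHf IHg|j f IHf].
- by rewrite ev_eps_cst coefC.
- by rewrite rmorphD coefD IHf IHg rmorphD.
- by rewrite !rmorphM ev_eps_x coef0M coefD coefC coefMX addr0 IHf ev_x.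
Qed.

(** Chain rule to first order: multiplying by [x j] adds the term [iter j dB w * ev f], which
    matches the extra term of [pd_xM] at [i = j]. *)
Lemma ev_eps_coef1 f : exists N, forall n, (N <= n)%N ->
  (ev_eps f)`_1 = \sum_(i < n) ev (pd i f) * iter i dB w.
Proof.
elim/J_ind: f => [c|f g [N fN] [M gM]|j f [N fN]].
- exists 0%N => n _; rewrite ev_eps_cst coefC big1 // => i _.
  by rewrite pd_cst rmorph0 mul0r.
- exists (maxn N M) => n le_n; rewrite rmorphD coefD (fN n) ?(gM n); try lia.
  by rewrite -big_split; apply: eq_bigr => i _; rewrite raddfD rmorphD mulrDl.
- exists (maxn N j.+1) => n le_n; have jn : (j < n)%N by lia.
  rewrite rmorphM ev_eps_x mulrDl coefD coefCM -mulrA coefCM coefXM /=.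
  rewrite ev_eps_coef0 (fN n); last by lia.
  rewrite mulr_sumr (bigD1 (Ordinal jn)) //= [RHS](bigD1 (Ordinal jn)) //=.
  rewrite pd_xM eqxx rmorphD rmorphM ev_x mulrDl mulrA (addrC _ (_ * ev f)).
  rewrite addrA (mulrC _ (ev f)); congr (_ + _).
  apply: eq_bigr => i /negPf; rewrite -val_eqE /= => ij.
  by rewrite pd_xM ij mulr0n add0r rmorphM ev_x mulrA.
Qed.

(** Replaces the bound produced by the induction by any bound on the variables of [f]. *)
Lemma ev_eps_coef1_bound n f : (forall i, (n <= i)%N -> pd i f = 0) ->
  (ev_eps f)`_1 = \sum_(i < n) ev (pd i f) * iter i dB w.
Proof.
move=> fn; have [N fN] := ev_eps_coef1 f.
rewrite (fN (maxn N n)) ?leq_maxl //.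
apply: (@eq_sum_pd _ _ _ _ (fun i g => ev g * iter i dB w)) => // i => [|le_i].
  by rewrite rmorph0 mul0r.
by rewrite fn //; lia.
Qed.

End DifferentialRing.

(** * The differential algebra over [k((z))], division by degree, and the Vainberg-Tonti formula *)

HB.instance Definition _ (I : choiceType) (R : comNzRingType) (i : I) :=
  GRing.isZmodMorphism.Build _ _ (@pderiv I R i)
    (pderiv_is_zmod_morphism (R := R) i).

Section DiffAlg.
Variable k : fieldType.
Hypothesis char0 : [pchar k] =i pred0.

Notation J := (diffalg k).
Notation x := (pvar (laurent k) : nat -> J).

Let cst : {rmorphism laurent k -> J} :=
  (@mkmalgU {cmonom nat} (laurent k) mone : {rmorphism _ -> _}).
Let pd (i : nat) : {additive J -> J} :=
  (@pderiv nat (laurent k) i : {additive _ -> _}).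

Lemma diffalg_ind (P : J -> Prop) :
  (forall c, P (cst c)) -> (forall f g, P f -> P g -> P (f + g)) ->
  (forall j f, P f -> P (x j * f)) -> forall f, P f.
Proof. exact: polys_ind. Qed.

Let pd_cst i c : pd i (cst c) = 0. Proof. exact: pderivC. Qed.

Let pd_xM i j f : pd i (x j * f) = f *+ (i == j) + x j * pd i f.
Proof. exact: pderivXM. Qed.

Let lderiv_term (m : {cmonom nat}) (c : laurent k) : J := << lderiv c *g m >>.

Let lderiv_termB m : zmod_morphism (lderiv_term m).
Proof.
by move=> c d; rewrite /lderiv_term lderiv_is_zmod_morphism monalgUB.
Qed.

Let dzE f : dz f = msupp_sum lderiv_term f + shift_deriv x pd f.
Proof. by []. Qed.

Fact dz_is_zmod_morphism : zmod_morphism (@dz k).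
Proof.
exact: (zmod_morphism_add (msupp_sum_is_zmod_morphism lderiv_termB)
  (shift_deriv_is_zmod_morphism diffalg_ind pd_cst pd_xM)).
Qed.

HB.instance Definition _ :=
  GRing.isZmodMorphism.Build _ _ (@dz k) dz_is_zmod_morphism.

Lemma dzC c : dz (cst c) = cst (lderiv c).
Proof.
rewrite dzE (shift_deriv_cst x pd_cst) addr0.
exact: (msupp_sumU lderiv_termB).
Qed.

(** Differentiating the coefficients commutes with multiplication by [x j], so the extra term comes
    from [shift_deriv] alone. *)
Lemma dzXM j f : dz (x j * f) = x j.+1 * f + x j * dz f.
Proof.
apply: etrans (congr2 +%R _ (shift_deriv_xM diffalg_ind pd_cst pd_xM j f)) _;
  last exact: etrans (addrCA _ _ _)
    (congr2 +%R (erefl _) (esym (mulrDr _ _ _))).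
move: f; apply: polys_additive_ext => [||c m].
- exact: zmod_morphism_comp (msupp_sum_is_zmod_morphism lderiv_termB)
    (zmod_morphism_mul _).
- exact: zmod_morphism_comp (zmod_morphism_mul _)
    (msupp_sum_is_zmod_morphism lderiv_termB).
- apply: etrans (etrans (congr1 _ (pvarMU j c m))
    (msupp_sumU lderiv_termB _ _)) _.
  apply: esym; apply: etrans (congr1 _ (msupp_sumU lderiv_termB c m)) _.
  exact: pvarMU.
Qed.

(** By the convention for inverses [t 0] is [0], so [t_mulrn] starts at [t 1]. *)
Let t (s : nat) : laurent k := lconst s%:R^-1.

Let deg_div_term (s : nat) (m : {cmonom nat}) (c : laurent k) : J :=
  << t (mdeg m + s) * c *g m >>.

Let deg_div_termB s m : zmod_morphism (deg_div_term s m).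
Proof. by move=> c d; rewrite /deg_div_term mulrBr monalgUB. Qed.

Definition deg_div (s : nat) : J -> J := msupp_sum (deg_div_term s).

HB.instance Definition _ s := GRing.isZmodMorphism.Build _ _ (deg_div s)
  (msupp_sum_is_zmod_morphism (deg_div_termB s)).

Lemma deg_divC s c : deg_div s (cst c) = cst (t s * c).
Proof.
apply: etrans (msupp_sumU (deg_div_termB s) c mone) _.
by rewrite /deg_div_term mdeg1.
Qed.

Lemma deg_divXM s j f : deg_div s (x j * f) = x j * deg_div s.+1 f.
Proof.
move: f; apply: polys_additive_ext => [||c m].
- exact: zmod_morphism_comp (msupp_sum_is_zmod_morphism (deg_div_termB s))
    (zmod_morphism_mul _).
- exact: zmod_morphism_comp (zmod_morphism_mul _)
    (msupp_sum_is_zmod_morphism (deg_div_termB s.+1)).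
- apply: etrans (etrans (congr1 _ (pvarMU j c m))
    (msupp_sumU (deg_div_termB s) _ _)) _.
  apply: esym; apply: etrans (congr1 _ (msupp_sumU (deg_div_termB s.+1) c m)) _.
  apply: etrans (pvarMU _ _ _) _.
  by rewrite /deg_div_term mdegM mdegU addnS addSn.
Qed.

Let t_mulrn s : t s.+1 *+ s.+1 = 1.
Proof.
have tE n : t s.+1 *+ n = lconst (s.+1%:R^-1 *+ n).
  elim: n => [|n IHn].
    by rewrite !mulr0n; apply/laurentP => i /=; case: eqP.
  rewrite mulrSr IHn [in RHS]mulrSr.
  exact: esym (zmod_morphismD (@lconst_is_zmod_morphism k) _ _).
by rewrite tE -[X in lconst X]mulr_natr mulVf ?((pcharf0P _).1 char0).
Qed.

Lemma diffalg_vainberg_tonti (f : J) (A := x 0%N * deg_div 1 f) :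
    (exists N, forall n, (N <= n)%N ->
      \sum_(i < n) (-1) ^+ i * iter i (@dz k) (x 0%N * pd i f) =
      \sum_(i < n) x i * pd i f) ->
  variational_derivative A = f.
Proof.
move=> fP.
have [N AN] := vainberg_tonti diffalg_ind pd_cst pd_xM
  (D := @dz k : {additive J -> J}) dzC dzXM
  (T := fun s => deg_div s : {additive J -> J}) deg_divC deg_divXM
  (fun s c => lderiv_lconstM _ c) t_mulrn fP.
have [M AM] := pd_eventually0 diffalg_ind pd_cst pd_xM A.
(* A bound large enough for the formula and also for all variables of [A], so that the finite sum is
   the full variational derivative. *)
rewrite -(AN (maxn N M)) ?leq_maxl //; apply: fsbig_nat_sum => i le_i.
rewrite [X in iter _ _ X](AM i); last by lia.
have -> : iter i (@dz k) 0 = 0 by elim: i {le_i} => //= i ->; rewrite raddf0.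
exact: mulr0.
Qed.

(** * Injectivity of the evaluation in characteristic zero *)

Lemma lcoefM_lowest (R : comNzRingType) (f g : laurent R) (N : int) :
    (forall i, i < N -> f i = 0) -> (forall i, i < 0 -> g i = 0) ->
  (f * g) N = f N * g 0.
Proof.
move=> fN g0; have := convE 0 fN g0.
by rewrite !addr0 big_ord1 subnn !addr0 => <-.
Qed.

(** Restriction to the arc space: only [y_i] with [i >= 0] survive, so [y(z)] becomes a power
    series. *)
Definition level0 (f : loopA k) : laurent (yalg k) := f 0%N.

Fact level0_is_zmod_morphism : zmod_morphism level0. Proof. by []. Qed.
Fact level0_is_monoid_morphism : monoid_morphism level0. Proof. by []. Qed.
HB.instance Definition _ :=
  GRing.isZmodMorphism.Build _ _ level0 level0_is_zmod_morphism.
HB.instance Definition _ :=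
  GRing.isMonoidMorphism.Build _ _ level0 level0_is_monoid_morphism.

Lemma level0_sum (T : Type) (r : seq T) F :
  level0 (\sum_(i <- r) F i) = \sum_(i <- r) level0 (F i).
Proof. exact: (rmorph_sum level0). Qed.

Lemma level0M f g : level0 (f * g) = level0 f * level0 g. Proof. by []. Qed.

Lemma level0_prod (T : Type) (r : seq T) F :
  level0 (\prod_(i <- r) F i) = \prod_(i <- r) level0 (F i).
Proof. exact: (rmorph_prod level0). Qed.

Lemma level0X f n : level0 (f ^+ n) = level0 f ^+ n.
Proof. exact: (rmorphXn level0). Qed.

Lemma level0_aderivn i f :
  level0 (iter i (@aderiv k) f) = iter i (@lderiv _) (level0 f).
Proof. by elim: i => //= i <-. Qed.

Lemma lcoef_sum (R : comNzRingType) (T : Type) (r : seq T)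
    (F : T -> laurent R) n : (\sum_(i <- r) F i) n = \sum_(i <- r) F i n.
Proof. exact: (big_morph (fun f : laurent R => f n)). Qed.

Lemma laurent_ge0_prod (R : comNzRingType) (T : Type) (r : seq T)
    (F : T -> laurent R) (c : T -> R) :
    (forall j i, i < 0 -> F j i = 0) -> (forall j, F j 0 = c j) ->
  (forall i, i < 0 -> (\prod_(j <- r) F j) i = 0) /\
  (\prod_(j <- r) F j) 0 = \prod_(j <- r) c j.
Proof.
move=> F0 Fc; elim: r => [|j r [IH0 IHc]].
  by rewrite !big_nil; split=> [i|]; rewrite lcoef1 // => /lt_eqF->.
rewrite !big_cons lcoefM_lowest //; last exact: F0.
rewrite IHc Fc; split=> // i i0.
by rewrite lcoefM (@conv_lt _ _ _ 0 0) // => l; apply: F0.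
Qed.

Lemma laurent_ge0_exp (R : comNzRingType) (F : laurent R) n :
    (forall i, i < 0 -> F i = 0) ->
  (forall i, i < 0 -> (F ^+ n) i = 0) /\ (F ^+ n) 0 = F 0 ^+ n.
Proof.
move=> F0; have := @laurent_ge0_prod R _ (index_enum 'I_n) (fun=> F)
  (fun=> F 0) (fun=> F0) (fun=> erefl).
by rewrite !prodr_const card_ord.
Qed.

Let slice_term (N : int) (m : {cmonom nat}) (c : laurent k) : polys k nat :=
  << c N *g m >>.

Let slice_termB N m : zmod_morphism (slice_term N m).
Proof. by move=> c d; rewrite /slice_term -monalgUB. Qed.

Lemma mcoeff_slice N f m :
  (msupp_sum (slice_term N) f)@_m = (f@_m : laurent k) N.
Proof.
move: f; apply: polys_additive_ext => [||c m'].
- exact: (zmod_morphism_comp (@mcoeffB _ _ m)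
    (msupp_sum_is_zmod_morphism (slice_termB N))).
- by move=> g h; rewrite mcoeffB.
- apply: etrans (congr1 _ (msupp_sumU (slice_termB N) c m')) _.
  by rewrite /slice_term !mcoeffU; case: eqP.
Qed.

(* The constant term of the i-th derivative of y, over k[y_i | i >= 0]. *)
Let yfact (i : nat) : yalg k := pvar k i%:Z *+ i`!.

Let yconst : {rmorphism k -> yalg k} :=
  (@mkmalgU {cmonom int} k mone : {rmorphism _ -> _}).

(** Every derivative of [y] is a power series here, so only the coefficients of [f] at [z^N] and the
    constant terms [yfact] contribute. *)
Lemma lcoef_deval_level0 N (f : J) :
    (forall m i, i < N -> (f@_m : laurent k) i = 0) ->
  level0 (deval f) N = psubst yconst yfact (msupp_sum (slice_term N) f).
Proof.
move=> fN.
rewrite /deval /psubst mmapE level0_sum lcoef_sum /msupp_sum raddf_sum.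
apply: eq_bigr => m _.
apply: etrans (esym (mmapU _ _)).
rewrite level0M level0_prod.
have Y0 i : i < 0 -> level0 (yseries k) i = 0.
  by rewrite /= /ytrunc oppr0 ltNge => /negPf->.
have YX0 i l : l < 0 -> level0 (iter i (@aderiv k) (yseries k) ^+ m i) l = 0.
  move=> l0; rewrite level0X level0_aderivn.
  by apply: (laurent_ge0_exp _ _).1 => // j; apply: lderivn_lt0.
have YXc i : level0 (iter i (@aderiv k) (yseries k) ^+ m i) 0 = yfact i ^+ m i.
  rewrite level0X level0_aderivn (laurent_ge0_exp _ _).2.
    by rewrite lcoef_lderivn0 /= /ytrunc oppr0.
  by move=> j; apply: lderivn_lt0.
have [P0 Pc] := laurent_ge0_prod (finsupp m) YX0 YXc.
rewrite lcoefM_lowest ?Pc // => i iN.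
by rewrite /= fN // monalgU0.
Qed.

(** Left inverse of [yfact]; negative indices, which [yfact] never produces, are sent to [0]. *)
Let xofy (i : int) : polys k nat :=
  if i is Posz n then (n`!%:R^-1)%:MP * pvar k n else 0.

Let xconst : {rmorphism k -> polys k nat} :=
  (@mkmalgU {cmonom nat} k mone : {rmorphism _ -> _}).

Lemma psubst_yfactK : cancel (psubst yconst yfact) (psubst xconst xofy).
Proof.
move=> f; elim/polys_ind: f => [c|f g IHf IHg|j f IHf].
- by rewrite !psubstC.
- apply: etrans (congr1 _ (rmorphD _ f g)) _.
  exact: etrans (rmorphD _ _ _) (congr2 +%R IHf IHg).
- have xjK : psubst xconst xofy (psubst yconst yfact (pvar k j)) = pvar k j.
    rewrite psubstX raddfMn /= psubstX /xofy -mulrnAl -monalgUMn.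
    rewrite -[X in X%:MP]mulr_natr mulVf ?mul1r //.
    by rewrite ((pcharf0P _).1 char0) -lt0n fact_gt0.
  apply: etrans (congr1 _ (rmorphM _ _ f)) _.
  exact: etrans (rmorphM _ _ _) (congr2 *%R xjK IHf).
Qed.

Lemma diffalg_lower_bound (f : J) :
  exists N : int, forall m i, i < N -> (f@_m : laurent k) i = 0.
Proof.
elim/polys_monom_ind: f => [f g [N fN] [M gM]|c m].
  exists (Order.min N M) => m i; rewrite lt_min => /andP[iN iM].
  by rewrite mcoeffD lcoefD fN ?gM ?addr0.
have [N cN] := laurent_bound c; exists N => m' i iN.
by rewrite mcoeffU; case: eqP => //= _; apply: cN.
Qed.

Lemma deval_eq0 (f : J) : deval f = 0 -> f = 0.
Proof.
move=> f0; have [N fN] := diffalg_lower_bound f.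
(* Once all coefficients below [N + K] vanish, the slice at [N + K] is determined by the value of
   [f], and so it vanishes too. *)
have fK (K : nat) m i : i < N + K%:Z -> (f@_m : laurent k) i = 0.
  elim: K m i => [|K IHK] m i iN; first by apply: fN; rewrite addr0 in iN.
  have [iK|iK] := ltP i (N + K%:Z); first exact: IHK.
  have -> : i = N + K%:Z by lia.
  rewrite -mcoeff_slice -[msupp_sum _ _]psubst_yfactK.
  by rewrite -lcoef_deval_level0 ?f0 //= rmorph0 mcoeff0.
apply/malgP => m; rewrite mcoeff0; apply/laurentP => i.
by apply: (fK (absz (i - N)).+1); lia.
Qed.

(** * Derivation, residue pairing and linearisation on the loop space *)

Fact aderiv_is_zmod_morphism : zmod_morphism (@aderiv k).
Proof.
by move=> f g; apply/limitP => n; apply: lderiv_is_zmod_morphism.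
Qed.
HB.instance Definition _ :=
  GRing.isZmodMorphism.Build _ _ (@aderiv k) aderiv_is_zmod_morphism.

Lemma aderivM (f g : loopA k) : aderiv (f * g) = aderiv f * g + f * aderiv g.
Proof. by apply/limitP => n; exact: (lderivM (f n) (g n)). Qed.

Lemma aderiv_const (c : laurent k) : aderiv (aconst c) = aconst (lderiv c).
Proof.
apply/limitP => n; apply/laurentP => i.
by rewrite /= /lderiv_fun raddfMz.
Qed.

Fact residue_is_zmod_morphism : zmod_morphism (@residue k).
Proof. by move=> f g; apply/limitP. Qed.
HB.instance Definition _ :=
  GRing.isZmodMorphism.Build _ _ (@residue k) residue_is_zmod_morphism.

Lemma residue_aderiv f : residue (@aderiv k f) = 0.
Proof. by apply/limitP => n; rewrite /= /lderiv_fun addNr mulr0z. Qed.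

(** Non-degeneracy of the residue pairing: the test function with [j = -1 - i] reads off the
    coefficient of [z^i]. *)
Lemma residueMzpow_eq0 (f : loopA k) :
  (forall j, residue (f * aconst (zpow k j)) = 0) -> f = 0.
Proof.
move=> f0; apply/limitP => n; apply/laurentP => i.
have /limitP/(_ n) := f0 (-1 - i).
have -> : residue (f * aconst (zpow k (-1 - i))) n
  = (f n * zpow _ (-1 - i)) (-1).
  change ((f n * lmap yconst (zpow k (-1 - i))) (-1)
    = (f n * zpow _ (-1 - i)) (-1)).
  suff -> : lmap yconst (zpow k (-1 - i)) = zpow (yalg k) (-1 - i) by [].
  by apply/laurentP => l /=; case: eqP => _; rewrite ?monalgU0.
rewrite lcoefMzpow; have -> // : -1 - (-1 - i) = i by lia.
Qed.

HB.instance Definition _ :=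
  GRing.RMorphism.copy (@deval k)
    (psubst (@aconst k) (fun i => iter i (@aderiv k) (yseries k))).

(** The arguments are swapped so that the map in [D] can carry a ring morphism structure. *)
Definition perturb w (D : J) : {poly loopA k} := deval_eps D w.

HB.instance Definition _ w :=
  GRing.RMorphism.copy (perturb w)
    (psubst (polyC \o @aconst k)
      (fun i => (iter i (@aderiv k) (yseries k))%:P
        + (iter i (@aderiv k) w)%:P * 'X)).

Lemma devalC c : deval (cst c) = aconst c. Proof. exact: psubstC. Qed.

Lemma devalX i : deval (x i) = iter i (@aderiv k) (yseries k).
Proof. exact: psubstX. Qed.

Lemma deval_eps_C w c : deval_eps (cst c) w = (deval (cst c))%:P.
Proof. by rewrite devalC; exact: psubstC. Qed.

Lemma deval_eps_X w i : deval_eps (x i) w =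
  (iter i (@aderiv k) (yseries k))%:P + (iter i (@aderiv k) w)%:P * 'X.
Proof. exact: psubstX. Qed.

Lemma aderiv_deval_cst c : aderiv (deval (cst c)) = deval (cst (lderiv c)).
Proof.
exact: etrans (congr1 _ (devalC c)) (etrans (aderiv_const c) (esym (devalC _))).
Qed.

Lemma linearisationE n D w : (forall i, (n <= i)%N -> pd i D = 0) ->
  linearisation D w = \sum_(i < n) deval (pd i D) * iter i (@aderiv k) w.
Proof.
exact: (@ev_eps_coef1_bound _ _ _ _ diffalg_ind _ pd_cst pd_xM _
  (@deval k : {rmorphism J -> loopA k}) _ _ devalX w
  (perturb w : {rmorphism J -> {poly loopA k}})
  (deval_eps_C w) (deval_eps_X w)).
Qed.

(** Compatibility tested on elements concentrated in degree [0] says that the linearisation is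
    self-adjoint. *)
Lemma framing_compatible_residue D f g : framing_compatible D ->
  residue (f * linearisation D g) = residue (@linearisation k D f * g).
Proof.
move=> /(_ (f, 0) (g, 0)); rewrite /framing_pairing /framing_d /=.
rewrite !mul0r raddf0 sub0r subr0 addrC => /eqP.
by rewrite subr_eq0 => /eqP.
Qed.

Lemma framing_compatible_adjoint D : framing_compatible D ->
  exists N, forall n, (N <= n)%N ->
    \sum_(i < n) (-1) ^+ i * iter i (@dz k) (x 0%N * pd i D) =
    \sum_(i < n) x i * pd i D.
Proof.
move=> Dsym; have [N DN] := pd_eventually0 diffalg_ind pd_cst pd_xM D.
exists N => n le_n.
have Dn i : (n <= i)%N -> pd i D = 0 by move=> /(leq_trans le_n); exact: DN.
set S := LHS; set S' := RHS; apply/eqP; rewrite -subr_eq0.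
(* The identity is checked after evaluation, and there by residues against all powers of [z]. *)
apply/eqP/deval_eq0; apply: etrans (rmorphB (@deval k) S S') _.
apply: residueMzpow_eq0 => j; set z := aconst _; rewrite mulrBl.
have S_lin : residue (deval S * z) = residue (yseries k * linearisation D z).
  rewrite (linearisationE _ Dn); apply: esym.
  exact: (residue_adjoint diffalg_ind pd (D := @dz k : {additive J -> J})
    dzC dzXM (ev := @deval k : {rmorphism J -> loopA k})
    (dB := @aderiv k : {additive _ -> _}) aderivM aderiv_deval_cst
    devalX (res := @residue k : {additive _ -> _}) n D z residue_aderiv).
(* The value of [x i] is the [i]-th derivative of [y], so the Euler sum of [D] evaluates to the
   linearisation applied to [y] itself. *)
have S'_lin :
    residue (deval S' * z) = residue (linearisation D (yseries k) * z).
  congr (residue (_ * z)); rewrite (linearisationE _ Dn).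
  apply: etrans (rmorph_sum (@deval k) _ _ _) _; apply: eq_bigr => i _.
  apply: etrans (rmorphM (@deval k) _ _) _; rewrite [LHS]mulrC.
  by congr (_ * _); exact: devalX.
apply: etrans (raddfB (@residue k) _ _) _.
apply: etrans (congr2 (fun a b => a - b)
  (etrans S_lin (framing_compatible_residue _ _ Dsym)) S'_lin) _.
exact: subrr.
Qed.

End DiffAlg.

Theorem theorem3p3 (k : fieldType) (char0 : [pchar k] =i pred0)
    (D : diffalg k) (symplecticD : residue_induces_symplectic D) :
  exists A : diffalg k, variational_derivative A = D.
Proof.
have [Dsym _] := symplecticD.
exists (pvar _ 0%N * deg_div 1 D).
exact: diffalg_vainberg_tonti char0 _ (framing_compatible_adjoint char0 Dsym).
Qed.
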